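(* Let $(G,+)$ be a finite abelian group. Any non-adaptive data structure for 3SUM-Indexing over $G$ with $T = 2$ probes and cell size $w = 1$ bit requires space $S = \Omega(|G|)$.
   Context: 3SUM-Indexing over a finite abelian group $(G,+)$: preprocess two sets $A_1, A_2 \subseteq G$, each of size $n$, into a data structure consisting of $S$ memory cells of $w$ bits each, so that given any query element $z \in G$ one can decide whether there exist $a_1 \in A_1$, $a_2 \in A_2$ with $a_1 + a_2 = z$, by accessing (probing) at most $T$ memory cells; the answer is a function of the contents of the probed cells. A data structure is non-adaptive if the set of cells probed on query $z$ is a function of $z$ alone. With $w=1$ (bit probe model) and $T=2$, each query $z$ reads two fixed bits and outputs a fixed Boolean function of them.
   Formalization: The set size n is restricted to 2 ≤ n < |G|/2: for n = 1, or n > |G|/2, or n = |G|/2 in groups such as Z/2p, data structures with space O(√|G|) or 0 exist, so the bound fails there. *)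

(* Defs.v *)
From HB Require Import structures.
From mathcomp Require Import all_boot all_order all_algebra.

Set Implicit Arguments.
Unset Strict Implicit.
Unset Printing Implicit Defensive.

Import Order.TTheory GRing.Theory Num.Theory.

Local Open Scope ring_scope.

Definition memory (S w : nat) : Type := {ffun 'I_S -> w.-tuple bool}.

(* What a query sees of a memory: the addresses and the contents of the       *)
(* probed cells, and None at every other address.                             *)
Definition probed_view (S w : nat) (P : {set 'I_S}) (m : memory S w) :
    {ffun 'I_S -> option (w.-tuple bool)} :=
  [ffun i => if i \in P then Some (m i) else None].

(* Non-adaptivity is built into the type of probes: the set of probed cells   *)
(* depends on the query only, not on the contents of the memory. No bound is  *)
(* put on the computational cost of preprocess and answer.                    *)
Record nonadaptive_ds (G : finZmodType) (S w : nat) := NonadaptiveDS {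
  preprocess : {set G} -> {set G} -> memory S w;
  probes : G -> {set 'I_S};
  answer : G -> {ffun 'I_S -> option (w.-tuple bool)} -> bool
}.

Definition query (G : finZmodType) (S w : nat) (D : nonadaptive_ds G S w)
    (m : memory S w) (z : G) : bool :=
  answer D z (probed_view (probes D z) m).

Definition solves_3SUM_indexing (G : finZmodType) (S w : nat) (n T : nat)
    (D : nonadaptive_ds G S w) : Prop :=
  (forall z : G, (#|probes D z| <= T)%N) /\
  (forall A1 A2 : {set G}, #|A1| = n -> #|A2| = n ->
   forall z : G,
     query D (preprocess D A1 A2) z <->
     (exists a1 a2 : G, [/\ a1 \in A1, a2 \in A2 & a1 + a2 = z])).

(* Main.v *)
(* Every query applies a Boolean function to two bits, i.e. it is an edge of  *)
(* a multigraph on the S cells. The function is either affine over F_2, or a  *)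
(* conjunction or a disjunction of two literals. More than 2S conjunctions    *)
(* contain edges e1, e, e3 such that yes at e1 and e3 forces yes at e, while  *)
(* some sumset contains e1 and e3 but not e. Among more than 2S disjunctions  *)
(* no at e1 and e3 forces no at e, while some sumset contains e but not e1    *)
(* and e3. More than 2(S+1) affine queries contain a cycle K of length        *)
(* O(log |G|), over which the xor of the answers is constant, while two       *)
(* sumsets differ on K at exactly one element: for |K| <= n let them cover K, *)
(* resp. K minus a point, and otherwise avoid K, resp. meet it in one point,  *)
(* which is possible because n(|K|+1) <= |G|.                                 *)
Require Import Defs.
From HB Require Import structures.
From mathcomp Require Import all_boot all_order all_algebra.
From mathcomp Require Import fingroup cyclic zify.

Set Implicit Arguments.
Unset Strict Implicit.
Unset Printing Implicit Defensive.

Import Order.TTheory GRing.Theory Num.Theory.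

Local Open Scope ring_scope.

(** * Sumsets with a prescribed trace on a small set *)

(** Too few cells force a relation among the answers to a few queries: an implication for
    conjunctions and disjunctions, a constant xor for affine functions. Each is refuted because
    sumsets of [n]-element sets take suitable values on these few elements.

    The implication comes from [middle_edge] and is refuted by [cover_avoid] or [avoid_two_hit]. The
    latter is delicate: missing two elements may forbid up to [2n] elements to one summand, so the
    other is built almost invariant under translation by their difference, which brings the loss
    down to about [n].

    The xor relation comes from [short_cycle] and is refuted by [flip_one]. Shortness matters:
    [#|K| ^ 2 <= #|G| + 1] ensures [#|K| <= n] or [n * (#|K| + 1) <= #|G|], whatever [n] is.
    [nonaffine_bound] and [affine_bound] turn this into bounds on the number of queries of each
    kind. *)

Lemma subset_card_between (T : finType) (A B : {set T}) (n : nat) :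
  A \subset B -> (#|A| <= n <= #|B|)%N ->
  exists C : {set T}, [/\ A \subset C, C \subset B & #|C| = n].
Proof.
move=> sAB; elim: n => [|n IHn] /andP[An nB].
  by exists A; split=> //; apply/eqP; rewrite -leqn0.
have [An'|An'] := leqP #|A| n; last first.
  by exists A; split=> //; apply/eqP; rewrite eqn_leq An.
have [|C [sAC sCB Cn]] := IHn; first by rewrite An' ltnW.
have /properP[_ [x xB xC]] : C \proper B by rewrite properEcard sCB Cn.
exists (x |: C); split.
- exact: subset_trans sAC (subsetU1 _ _).
- by rewrite subUset sub1set xB.
- by rewrite cardsU1 xC Cn.
Qed.

Definition sumset (G : finZmodType) (A B : {set G}) : {set G} :=
  [set a + b | a in A, b in B].

Section Sumset.
Variable G : finZmodType.
Implicit Types (A B X Y Z : {set G}) (t z : G) (n : nat).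

Definition reflection t A : {set G} := [set t - a | a in A].

Lemma card_reflection t A : #|reflection t A| = #|A|.
Proof. by rewrite card_imset // => a b /addrI /oppr_inj. Qed.

Lemma mem_reflection t A x : (x \in reflection t A) = (t - x \in A).
Proof.
apply/imsetP/idP => [[a aA ->]|tx]; first by rewrite subKr.
by exists (t - x); rewrite ?subKr.
Qed.

Lemma card_setC (C : {set G}) : (#|C| + #|~: C|)%N = #|G|.
Proof. exact: cardsC. Qed.

Lemma card_setT : #|[set: G]| = #|G|.
Proof. exact: cardsT. Qed.

Lemma card_setC_ge (C : {set G}) n : (#|C| + n <= #|G|)%N -> (n <= #|~: C|)%N.
Proof. by have := card_setC C; lia. Qed.

Lemma notin_sumset t A B :
  (t \notin sumset A B) = (B \subset ~: reflection t A).
Proof.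
apply/idP/subsetP => [tN b bB|sB].
  rewrite inE mem_reflection; apply: contra tN => tbA.
  by apply/imset2P; exists (t - b) b; rewrite ?subrK.
apply/negP => /imset2P[a b aA /sB + tE].
by rewrite inE mem_reflection tE addrK aA.
Qed.

Lemma sumsetS A B A' B' :
  A \subset A' -> B \subset B' -> sumset A B \subset sumset A' B'.
Proof. exact: imset2S. Qed.

(** Each [z] in [Z] costs one new element per side: [x] in [A] and [z - x] in [B]. The new sums
    avoid [t] when [x] lies outside [t - B] and [A + (z - t)], which together have fewer than [#|G|]
    elements. *)
Lemma cover_avoid_small Z t :
  t \notin Z -> (2 * #|Z| <= #|G|)%N ->
  exists A B, [/\ (#|A| <= #|Z|)%N, (#|B| <= #|Z|)%N,
                  Z \subset sumset A B & t \notin sumset A B].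
Proof.
have [m] := ubnP #|Z|; elim: m Z => // m IHm Z Zm tZ ZG.
have [->|[z zZ]] := set_0Vmem Z.
  exists set0, set0; rewrite cards0 sub0set; split=> //.
  by apply/negP => /imset2P[a b]; rewrite inE.
have cZ := cardsD1 z Z; rewrite zZ add1n in cZ.
have [|||A [B [cA cB sZ tAB]]] := IHm (Z :\ z); try lia.
  by rewrite !inE negb_and tZ orbT.
pose C := reflection t B :|: [set a + (z - t) | a in A].
have cC : (#|C| < #|G|)%N.
  have [+ _] := leq_card_setU (reflection t B) [set a + (z - t) | a in A].
  have -> : #|[set a + (z - t) | a in A]| = #|A| by apply: card_imset => ? ? /addIr.
  rewrite card_reflection.
  by move=> cC; apply: leq_ltn_trans cC _; lia.
have [x xC] : exists x, x \in ~: C by apply/card_gt0P; apply: card_setC_ge; lia.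
have /norP[xB xA] : ~~ ((x \in reflection t B) || (x \in [set a + (z - t) | a in A])).
  by rewrite -in_setU -in_setC.
have zt : z != t by apply: contraNneq tZ => <-.
exists (x |: A), ((z - x) |: B); split.
- by rewrite cardsU1; case: (x \notin A); lia.
- by rewrite cardsU1; case: (z - x \notin B); lia.
- apply/subsetP => y yZ; have [->|yz] := eqVneq y z.
    by apply/imset2P; exists x (z - x); rewrite ?setU11 // addrC subrK.
  apply: (subsetP (sumsetS (subsetU1 _ _) (subsetU1 _ _))).
  by apply: (subsetP sZ); rewrite !inE yz.
- apply/imset2P => -[a b]; rewrite !inE => /orP[/eqP ->|aA] /orP[/eqP ->|bB].
  + by rewrite addrC subrK => /esym; apply/eqP.
  + by move=> tE; move: xB; rewrite mem_reflection tE addrC addKr bB.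
  + move=> tE; case/negP: xA; apply/imsetP; exists a => //.
    by rewrite tE !addrA subKr.
  + by move=> tE; case/negP: tAB; apply/imset2P; exists a b.
Qed.

(** Padding preserves the avoidance of [t] if [A] grows outside [t - B], and then [B] outside
    [t - A']. *)
Lemma cover_avoid Z t n :
  t \notin Z -> (#|Z| <= n)%N -> (2 * n <= #|G|)%N ->
  exists A B, [/\ #|A| = n, #|B| = n, Z \subset sumset A B
                & t \notin sumset A B].
Proof.
move=> tZ Zn nG; have [|A [B [cA cB sZ tAB]]] := cover_avoid_small tZ; first lia.
have [||A' [sA sA' cA']] := @subset_card_between _ A (~: reflection t B) n.
- apply/subsetP => a aA; rewrite inE mem_reflection; apply: contra tAB => taB.
  by apply/imset2P; exists a (t - a); rewrite // addrC subrK.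
- by rewrite (leq_trans cA Zn) card_setC_ge // card_reflection; lia.
have [||B' [sB sB' cB']] := @subset_card_between _ B (~: reflection t A') n.
- apply/subsetP => b bB; rewrite inE mem_reflection.
  by apply/negP => /(subsetP sA'); rewrite inE mem_reflection subKr bB.
- by rewrite (leq_trans cB Zn) card_setC_ge // card_reflection; lia.
exists A', B'; split=> //; last by rewrite notin_sumset.
exact: subset_trans sZ (sumsetS sA sB).
Qed.

Lemma cover_all Z n : (0 < n)%N -> (#|Z| <= n)%N -> (n <= #|G|)%N ->
  exists A B, [/\ #|A| = n, #|B| = n & Z \subset sumset A B].
Proof.
move=> n0 Zn nG.
have [||A [sA _ cA]] := @subset_card_between _ Z setT n; rewrite ?subsetT //.
  by rewrite Zn card_setT.
have [||B [sB _ cB]] := @subset_card_between _ [set (0 : G)] setT n; rewrite ?subsetT //.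
  by rewrite cards1 n0 card_setT.
exists A, B; split=> //; apply/subsetP => z zZ.
apply/imset2P; exists z 0; rewrite ?addr0 //; first exact: (subsetP sA).
by rewrite -sub1set.
Qed.

Definition forbidden Z A : {set G} := [set z - a | z in Z, a in A].

Lemma card_forbidden Z A : (#|forbidden Z A| <= #|A| * #|Z|)%N.
Proof.
rewrite /forbidden curry_imset2X mulnC -cardsX; exact: leq_imset_card.
Qed.

Lemma avoid Z A B : B \subset ~: forbidden Z A ->
  forall z, z \in Z -> z \notin sumset A B.
Proof.
move=> sB z zZ; rewrite notin_sumset; apply: subset_trans sB _.
rewrite setCS; apply/subsetP => _ /imsetP[a aA ->].
by apply/imset2P; exists z a.
Qed.

Lemma avoid_all Z n : (n * #|Z|.+1 <= #|G|)%N ->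
  exists A B, [/\ #|A| = n, #|B| = n & forall z, z \in Z -> z \notin sumset A B].
Proof.
move=> nG.
have [||A [_ _ cA]] := @subset_card_between _ set0 [set: G] n; rewrite ?sub0set //.
  by rewrite cards0 card_setT; nia.
have := card_forbidden Z A; rewrite cA => cF.
have [||B [_ sB cB]] := @subset_card_between _ set0 (~: forbidden Z A) n; rewrite ?sub0set //.
  by rewrite cards0 card_setC_ge //; nia.
by exists A, B; split=> //; apply: avoid.
Qed.

Lemma avoid_hit Z t n : t \notin Z -> (0 < n)%N -> (n * #|Z|.+1 <= #|G|)%N ->
  exists A B, [/\ #|A| = n, #|B| = n, t \in sumset A B
                & forall z, z \in Z -> z \notin sumset A B].
Proof.
move=> tZ n0 nG.
have [||A [tA sA cA]] := @subset_card_between _ [set t] (~: Z) n.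
- by rewrite sub1set inE.
- by rewrite cards1 n0 card_setC_ge //; nia.
have := card_forbidden Z A; rewrite cA => cF.
have [||B [tB sB cB]] := @subset_card_between _ [set 0] (~: forbidden Z A) n.
- rewrite sub1set inE; apply/imset2P => -[z a zZ aA /esym/eqP].
  by rewrite subr_eq0 => /eqP za; move: (subsetP sA a aA); rewrite inE -za zZ.
- by rewrite cards1 n0 card_setC_ge //; nia.
exists A, B; split=> //; last exact: avoid.
by apply/imset2P; exists t 0; rewrite ?addr0 // -sub1set.
Qed.

(** Makes the parity of a sumset on [Z] take both values, against a constant xor over a cycle. *)
Lemma flip_one Z n : Z != set0 -> (0 < n)%N -> (2 * n <= #|G|)%N ->
  (#|Z| <= n)%N || (n * #|Z|.+1 <= #|G|)%N ->
  exists t A B A' B',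
    [/\ t \in Z, [/\ #|A| = n, #|B| = n, #|A'| = n & #|B'| = n],
        t \in sumset A B, t \notin sumset A' B'
      & forall z, z \in Z -> z != t -> (z \in sumset A B) = (z \in sumset A' B')].
Proof.
case/set0Pn => t tZ n0 nG.
have cZ := cardsD1 t Z; rewrite tZ add1n in cZ.
have tZ' : t \notin Z :\ t by rewrite !inE eqxx.
case/orP => Zn.
  have [|A [B [cA cB sZ]]] := @cover_all Z n n0 Zn; first lia.
  have [|A' [B' [cA' cB' sZ' tN]]] := @cover_avoid (Z :\ t) t n tZ' _ nG; first lia.
  exists t, A, B, A', B'; split=> //; first exact: (subsetP sZ).
  by move=> z zZ zt; rewrite (subsetP sZ) // (subsetP sZ') // !inE zt.
have [A' [B' [cA' cB' avZ]]] := avoid_all Zn.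
have [|A [B [cA cB tAB avZ']]] := @avoid_hit (Z :\ t) t n tZ' n0; first nia.
exists t, A, B, A', B'; split=> //; first exact: avZ.
move=> z zZ zt; rewrite (negPf (avZ z zZ)); apply/negbTE/avZ'.
by rewrite !inE zt.
Qed.

End Sumset.

(** * Sumsets missing two given elements and hitting a third *)

Section Arcs.
Variables (G : finZmodType) (d : G).
Let m := #[d]%g.
Implicit Types (W Y P : {set G}) (w : G).

Definition translate Y : {set G} := [set y + d | y in Y].

Definition arc w (k : nat) : {set G} := [set w + d *+ i | i : 'I_k].

Lemma mulrn_order : d *+ m = 0.
Proof. by rewrite -FinRing.zmodXgE expg_order. Qed.

Lemma mulrn_order_inj i j : (i < m)%N -> (j < m)%N -> d *+ i = d *+ j -> i = j.
Proof.
move=> im jm ij; apply/eqP.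
have := eq_expg_mod_order d i j.
by rewrite !FinRing.zmodXgE ij eqxx !modn_small // => <-.
Qed.

Lemma order_dvd_card : (m %| #|G|)%N.
Proof. by have := order_dvdG (in_setT d); rewrite cardsT. Qed.

Lemma arcP w k x : reflect (exists2 i, (i < k)%N & x = w + d *+ i) (x \in arc w k).
Proof.
apply: (iffP imsetP) => [[i _ ->]|[i ik ->]]; first by exists i.
by exists (Ordinal ik).
Qed.

Lemma card_arc_le w k : (#|arc w k| <= k)%N.
Proof. by rewrite -{2}(card_ord k); apply: leq_imset_card. Qed.

Lemma card_arc w k : (k <= m)%N -> #|arc w k| = k.
Proof.
move=> km; rewrite card_imset ?card_ord // => i j /addrI ij.
by apply: ord_inj; apply: mulrn_order_inj ij; apply: leq_trans km.
Qed.

Lemma arcS w k : arc w k \subset arc w k.+1.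
Proof. by apply/subsetP => x /arcP[i ik ->]; apply/arcP; exists i; rewrite // ltnW. Qed.

Lemma translate_arc w k : translate (arc w k) \subset arc w k.+1.
Proof.
apply/subsetP => _ /imsetP[_ /arcP[i ik ->] ->].
by apply/arcP; exists i.+1; rewrite // mulrSr addrA.
Qed.

Lemma translateU Y P : translate (Y :|: P) = translate Y :|: translate P.
Proof. exact: imsetU. Qed.

Lemma translateC Y : translate (~: Y) = ~: translate Y.
Proof.
apply/setP => x; rewrite inE; apply/imsetP/idP => [[y yY ->]|xY].
  apply/imsetP => -[y' y'Y /addIr yy']; move: yY; by rewrite inE yy' y'Y.
exists (x - d); rewrite ?subrK // inE; apply: contra xY => xY.
by apply/imsetP; exists (x - d); rewrite ?subrK.
Qed.

Lemma translate_coset w : translate (arc w m) = arc w m.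
Proof.
apply/eqP; rewrite eqEcard [#|translate _|]card_imset ?leqnn ?andbT; last exact: addIr.
apply/subsetP => _ /imsetP[_ /arcP[i im ->] ->]; rewrite -addrA -mulrSr.
apply/arcP; have [im'|] := ltnP i.+1 m; first by exists i.+1.
move=> mi; have -> : i.+1 = m by apply/eqP; rewrite eqn_leq mi im.
by exists 0%N; rewrite ?order_gt0 // mulrn_order mulr0n.
Qed.

Lemma coset_sub W w : translate W = W -> w \in W -> arc w m \subset W.
Proof.
move=> tW wW; apply/subsetP => _ /arcP[i _ ->].
elim: i => [|i IHi]; first by rewrite mulr0n addr0.
by rewrite mulrSr addrA -tW; apply: imset_f.
Qed.

(* Stack whole cosets of <d>, then one arc: only the arc gains an element     *)
(* under translation by d.                                                    *)
Lemma packing_from W w k : translate W = W -> w \in W -> (0 < k <= #|W|)%N ->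
  exists Y P, [/\ w \in Y, Y :|: translate Y \subset P, P \subset W, #|Y| = k
                & (#|P| <= k + ~~ (m %| k))%N].
Proof.
have [c] := ubnP k; elim: c W w k => // c IHc W w k kc tW wW /andP[k0 kW].
have m0 : (0 < m)%N by apply: order_gt0.
have [km|mk] := ltnP k m.
  exists (arc w k), (arc w k.+1); split.
  - by apply/arcP; exists 0%N; rewrite ?mulr0n ?addr0.
  - by rewrite subUset arcS translate_arc.
  - apply: subset_trans (coset_sub tW wW).
    by apply/subsetP => _ /arcP[i ik ->]; apply/arcP; exists i; rewrite // (leq_trans ik).
  - by rewrite card_arc // ltnW.
  - by rewrite (leq_trans (card_arc_le _ _)) // gtnNdvd // addn1.
have sC := coset_sub tW wW; have tC := translate_coset w.
have wC : w \in arc w m by apply/arcP; exists 0%N; rewrite ?mulr0n ?addr0.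
have [km|km] := eqVneq k m.
  exists (arc w m), (arc w m); rewrite tC setUid km card_arc //; split=> //.
  exact: leq_addr.
have tW' : translate (W :\: arc w m) = W :\: arc w m.
  have -> : W :\: arc w m = ~: (~: W :|: arc w m) by rewrite setCU setCK setDE.
  by rewrite translateC translateU translateC tW tC.
have cW : (#|W :\: arc w m| + m)%N = #|W|.
  by rewrite -(cardsID (arc w m) W) (setIidPr sC) card_arc // addnC.
have [w' w'W] : exists w', w' \in W :\: arc w m by apply/card_gt0P; lia.
have [||Y [P [_ sYP sPW cY cP]]] := IHc _ w' (k - m)%N _ tW' w'W; try lia.
have sPC : [disjoint P & arc w m].
  apply/pred0P => x /=; apply/negP => /andP[/(subsetP sPW)].
  by rewrite inE => /andP[/negP].
exists (Y :|: arc w m), (P :|: arc w m); split.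
- by rewrite inE wC orbT.
- by rewrite translateU tC setUACA setUid setSU.
- by rewrite subUset sC (subset_trans sPW) ?subsetDl.
- rewrite cardsU card_arc // (_ : Y :&: _ = set0) ?cards0 ?cY; first by rewrite subn0 subnK.
  apply: disjoint_setI0; apply: disjointWl sPC.
  by apply: subset_trans sYP; apply: subsetUl.
- have [+ _] := leq_card_setU P (arc w m); rewrite card_arc // => cPC.
  apply: leq_trans cPC _; move: cP; rewrite dvdn_subl //; case: (m %| k)%N; lia.
Qed.

Lemma packing W k : translate W = W -> (k <= #|W|)%N ->
  exists Y P, [/\ Y :|: translate Y \subset P, P \subset W, #|Y| = k
                & (#|P| <= k + ~~ (m %| k))%N].
Proof.
move=> tW kW; have [->|k0] := posnP k.
  by exists set0, set0; split; rewrite ?/translate ?imset0 ?setU0 ?cards0 ?sub0set.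
have [w wW] : exists w, w \in W by apply/card_gt0P; apply: leq_trans kW.
have [|Y [P [_ ? ? ? ?]]] := packing_from tW wW (k := k); first by rewrite k0.
by exists Y, P.
Qed.

(* With Y = z1 - A2, d = z2 - z1 and s = t - z1, a set A1 disjoint from P and *)
(* containing y + s makes A1 + A2 miss z1 and z2 and hit t.                  *)
Definition separated (n : nat) (s : G) := exists Y P y,
  [/\ #|Y| = n, Y :|: translate Y \subset P, (#|P| + n <= #|G|)%N, y \in Y
    & y + s \notin P].

(** The complement of the coset of [s] is a union of cosets containing 0. Packing [Y] and its
    translate there leaves [0 + s] outside [P]. *)
Lemma separated_outside n s : (0 < n)%N -> (2 * n < #|G|)%N -> s \notin arc 0 m ->
  separated n s.
Proof.
move=> n0 nG sH; have m0 : (0 < m)%N by apply: order_gt0.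
have cH w : #|arc w m| = m by rewrite card_arc.
have m2 : (2 * m <= #|G|)%N.
  have := order_dvd_card; have := card_setC (arc 0 m); rewrite cH.
  have : (0 < #|~: arc 0%R m|)%N by apply/card_gt0P; exists s; rewrite inE.
  move=> h0 h1 /dvdnP[[|[|q]] h2]; rewrite ?mul0n ?mul1n in h2; lia.
have tW : translate (~: arc s m) = ~: arc s m by rewrite translateC translate_coset.
have W0 : 0 \in ~: arc s m.
  rewrite inE; apply: contra sH => /arcP[i im si]; apply/arcP.
  have [i0|i0] := posnP i.
    by exists 0%N => //; rewrite addr0 si i0 mulr0n addr0.
  exists (m - i)%N; first by lia.
  by rewrite mulrnBr ?mulrn_order ?add0r 1?ltnW //; apply/eqP; rewrite -addr_eq0 -si.
have [|Y [P [Y0 sYP sPW cY cP]]] := packing_from tW W0 (k := n).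
  by have := card_setC (arc s m); rewrite cH; lia.
exists Y, P, 0; split=> //.
  by move: cP; case: (m %| n)%N; lia.
rewrite add0r; apply/negP => /(subsetP sPW); rewrite inE => /negP; apply.
by apply/arcP; exists 0%N; rewrite ?mulr0n ?addr0.
Qed.

(** [Y] is an arc of length [a] in the subgroup of [d], together with [n - a] elements packed
    outside that subgroup. *)
Lemma separated_inside n j a : (1 < j < m)%N -> (0 < a <= n)%N -> (a.+1 < m)%N ->
  (n - a + m <= #|G|)%N ->
  (a.+1 + (n - a) + ~~ (m %| n - a) + n <= #|G|)%N -> separated n (d *+ j).
Proof.
move=> jm an am nG nG'.
have tW : translate (~: arc 0 m) = ~: arc 0 m by rewrite translateC translate_coset.
have cH : #|arc 0 m| = m by rewrite card_arc.
have [|Y [P [sYP sPW cY cP]]] := packing (k := n - a) tW.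
  by have := card_setC (arc 0 m); rewrite cH; lia.
have arc_sub k : (k <= m)%N -> arc 0 k \subset arc 0 m.
  by move=> km; apply/subsetP => x /arcP[i ik ->]; apply/arcP; exists i; rewrite // (leq_trans ik).
have disjH x : x \in P -> x \notin arc 0 m by move=> /(subsetP sPW); rewrite inE.
(* The subtraction truncates: for [j <= a.+1] the element [y + s] is [d *+ a.+1], just past the arc
   of [P]; for larger [j], [y] is 0 and [y + s] is [d *+ j], further on. *)
exists (arc 0 a :|: Y), (arc 0 a.+1 :|: P), (d *+ (a.+1 - j)); split.
- rewrite cardsU card_arc ?cY; last by lia.
  rewrite (_ : _ :&: Y = set0) ?cards0; first by lia.
  apply: disjoint_setI0; rewrite disjoint_sym; apply/pred0P => x; apply/negP => /andP[/= xY].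
  move/(subsetP (arc_sub a (ltnW (ltnW am)))); apply/negP/disjH.
  by apply: (subsetP sYP); rewrite inE xY.
- by rewrite translateU setUACA setUSS // subUset arcS translate_arc.
- have [+ _] := leq_card_setU (arc 0 a.+1) P; have := card_arc_le 0 a.+1; lia.
- by rewrite inE; apply/orP; left; apply/arcP; exists (a.+1 - j)%N; rewrite ?add0r //; lia.
- rewrite -mulrnDr inE negb_or; apply/andP; split.
    apply/arcP => -[i ia]; rewrite add0r => /mulrn_order_inj; lia.
  apply/negP => /disjH /arcP; apply; exists (a.+1 - j + j)%N; rewrite ?add0r //; lia.
Qed.

Lemma separated_exists n s : (0 < n)%N -> (2 * n < #|G|)%N -> s != 0 -> s != d ->
  separated n s.
Proof.
move=> n0 nG s0 sd.
have [|] := boolP (s \in arc 0 m); last exact: separated_outside.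
case/arcP=> j jm; rewrite add0r => sE.
have j1 : (1 < j)%N.
  by case: j {jm} sE s0 sd => [|[|j]] // ->; rewrite ?mulr0n ?mulr1n eqxx.
have [q qm] := dvdnP order_dvd_card; rewrite -/m in qm.
rewrite sE.
(* When 2n + 1 = |G| only one element can be wasted, so the arc inside <d>    *)
(* must have the length (m - 1)/2 that leaves whole cosets outside.           *)
have [nG1|nG1] := eqVneq (2 * n).+1 #|G|.
  have [q2 q2E] : exists q2, q = (2 * q2).+1.
    by exists q./2; have := odd_double_half q; case: (odd q) => /=; nia.
  have [m2 m2E] : exists m2, m = (2 * m2).+1.
    by exists m./2; have := odd_double_half m; case: (odd m) => /=; nia.
  have nE : (n = q2 * m + m2)%N by nia.
  have nm : (n - m2 = q2 * m)%N by nia.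
  by apply: (@separated_inside n j m2); rewrite ?nm ?dvdn_mull //; nia.
(* If [d] generates [G], [Y] is a single arc. Otherwise two elements may be wasted: one next to a
   one-element arc, one outside the subgroup. *)
have [q1|q1] := eqVneq q 1%N.
  by apply: (@separated_inside n j n); rewrite ?subnn ?dvdn0 //; nia.
by apply: (@separated_inside n j 1); nia.
Qed.

End Arcs.

Lemma avoid_two_hit (G : finZmodType) (t z1 z2 : G) (n : nat) :
  (0 < n)%N -> (2 * n < #|G|)%N -> t != z1 -> t != z2 ->
  exists A B : {set G}, [/\ #|A| = n, #|B| = n, t \in sumset A B, z1 \notin sumset A B
                & z2 \notin sumset A B].
Proof.
move=> n0 nG t1 t2.
have [||Y [P [y [cY sYP cP yY ysP]]]] := @separated_exists G (z2 - z1) n (t - z1) n0 nG.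
- by rewrite subr_eq0.
- by apply: contra t2 => /eqP /addIr ->.
have [||A [yA sA cA]] := @subset_card_between _ [set y + (t - z1)] (~: P) n.
- by rewrite sub1set inE.
- by rewrite cards1 n0 card_setC_ge.
exists A, (reflection z1 Y); split; rewrite ?card_reflection //.
- apply/imset2P; exists (y + (t - z1)) (z1 - y); rewrite -?sub1set //.
    by rewrite sub1set mem_reflection subKr.
  by rewrite addrC addrA subrK addrC subrK.
- rewrite notin_sumset; apply/subsetP => b; rewrite mem_reflection => bY.
  rewrite inE mem_reflection; apply/negP => /(subsetP sA); rewrite inE => /negP[].
  by apply: (subsetP sYP); rewrite inE bY.
- rewrite notin_sumset; apply/subsetP => b; rewrite mem_reflection => bY.
  rewrite inE mem_reflection; apply/negP => /(subsetP sA); rewrite inE => /negP[].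
  apply: (subsetP sYP); rewrite inE; apply/orP; right; apply/imsetP.
  by exists (z1 - b) => //; rewrite [RHS]addrC addrA subrK.
Qed.

(** * Short cycles in dense multigraphs *)

Section ShortCycle.
Local Open Scope nat_scope.

Variables (E V : finType) (l r : E -> V).
Implicit Types (K p q : {set E}) (x : V -> bool).

Definition symdiff p q : {set E} := [set e | (e \in p) (+) (e \in q)].

Lemma card_symdiff p q : #|symdiff p q| <= #|p| + #|q|.
Proof.
apply: leq_trans (leq_card_setU p q); apply/subset_leq_card/subsetP => e.
by rewrite !inE; case: (e \in p); case: (e \in q).
Qed.

(* p is a cycle when its flow vanishes for every x, and a path from u to v,   *)
(* up to cycles, when its flow is x u (+) x v for every x.                    *)
Definition flow x p : bool := \big[addb/false]_(e in p) (x (l e) (+) x (r e)).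

Lemma flow_symdiff x p q : flow x (symdiff p q) = flow x p (+) flow x q.
Proof.
rewrite /flow !(big_mkcond (fun e => e \in _)) -big_split /=.
by apply: eq_bigr => e _; rewrite inE; case: (e \in p); case: (e \in q) => //=;
   rewrite ?addbb ?addbF.
Qed.

Lemma flow1 x e : flow x [set e] = x (l e) (+) x (r e).
Proof. by rewrite /flow big_set1. Qed.

(* The subgraph induced by the W chosen below has the property that every     *)
(* U inside W is touched by at least 2 * #|U| of its edges. Growing a tree    *)
(* from a vertex of W, each edge touching the current tree either is a tree   *)
(* edge of the next layer or closes a short cycle, so without short cycles    *)
(* each layer doubles the number of vertices.                                 *)
Lemma short_cycle (F : {set E}) (k : nat) :
  2 * #|V| < #|F| -> #|V| < 2 ^ k ->
  exists K : {set E},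
    [/\ K \subset F, K != set0, #|K| <= 2 * k & forall x, flow x K = false].
Proof.
move=> VF Vk.
pose inside (W : {set V}) := [set e in F | (l e \in W) && (r e \in W)].
(* Deleting [U] from [W] loses the edges touching [U] and gains [2 * #|U|], so a maximizer has the
   announced property. *)
pose excess W := #|inside W| + 2 * #|~: W|.
have [W _ Wmax] := @arg_maxnP _ setT xpredT excess isT.
pose touching (U : {set V}) := [set e in inside W | (l e \in U) || (r e \in U)].
have touch (U : {set V}) : U \subset W -> 2 * #|U| <= #|touching U|.
  move=> sUW; have := Wmax (W :\: U) isT.
  rewrite /excess.
  have -> : inside (W :\: U) = inside W :\: touching U.
    apply/setP => e; rewrite !inE.
    by case: (e \in F); case: (l e \in W); case: (r e \in W);
       case: (l e \in U); case: (r e \in U).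
  have := cardsID (touching U) (inside W).
  have /setIidPr -> : touching U \subset inside W by apply/subsetP => e; rewrite inE; case/andP.
  have := cardsC W; have := cardsC (W :\: U).
  have := cardsID U W; move/setIidPr: sUW => ->; rewrite /excess; lia.
(* The empty set has excess [2 * #|V|], below the excess [#|F|] of the full vertex set. *)
have [v vW] : exists v, v \in W.
  apply/set0Pn; apply: contraTneq VF => W0.
  have := Wmax setT isT; rewrite /excess W0 setCT setC0 cards0 cardsT.
  have -> : inside setT = F by apply/setP => e; rewrite !inE !andbT.
  have -> : inside set0 = set0 by apply/setP => e; rewrite !inE; case: (e \in F).
  by rewrite cards0 -leqNgt; lia.
have [/existsP[K /and4P[sKF K0 cK /forallP xK]]|noK] :=
    boolP [exists K : {set E}, [&& K \subset F, K != set0, #|K| <= 2 * k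
      & [forall x : {ffun V -> bool}, flow x K == false]]].
  exists K; split=> // x; rewrite -(eqP (xK [ffun u => x u])).
  by apply: eq_bigr => e _; rewrite !ffunE.
(* [U] is a ball around [v], [p u] a tree path from [v] to [u], and [Q] contains the tree edges. *)
suff [U [p [Q []]]] : exists (U : {set V}) (p : V -> {set E}) (Q : {set E}),
   [/\ U \subset W, 2 ^ k <= #|U|, #|Q| <= #|U|, Q \subset F &
     forall u, u \in U -> [/\ p u \subset Q, #|p u| <= k
        & forall x, flow x (p u) = x v (+) x u]].
  by move=> _ kU *; exfalso; have := max_card U; lia.
have : k <= k by []; elim: {1 3 4}k => [|i IHi] ik.
  exists [set v], (fun=> set0), set0.
  rewrite sub1set cards1 !cards0 sub0set; split=> // u; rewrite inE => /eqP ->.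
  by split=> [||x]; rewrite ?sub0set ?cards0 // /flow big_set0 addbb.
have [|U [p [Q [sUW iU QU QF pU]]]] := IHi; first exact: ltnW.
pose link u e := (e \in inside W) &&
  ((l e == u) && (r e \in U) || (r e == u) && (l e \in U)).
pose U' := U :|: [set u in W | [exists e, link u e]].
have [pe peP] : exists pe : V -> E, forall u, u \in U' :\: U -> link u (pe u).
  have [e0 _|noE] := pickP (@predT E); last first.
    have E0 : #|F| = 0 by apply: eq_card0 => e; have := noE e.
    by move: VF; rewrite E0.
  exists (fun u => odflt e0 [pick e | link u e]) => u.
  rewrite !inE => /andP[/negPf -> /andP[_ /existsP[e ue]]].
  by case: pickP => // /(_ e); rewrite ue.
pose other u e := if l e == u then r e else l e.
have otherP u e : u \notin U -> link u e ->
    other u e \in U /\ forall x, x (l e) (+) x (r e) = x (other u e) (+) x u.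
  rewrite /link /other => uU /andP[_]; case: (eqVneq (l e) u) => [->|lu /=].
    by rewrite (negPf uU) andbF orbF /=; split=> // x; rewrite addbC.
  by case/andP=> /eqP -> ->.
pose p' u := if u \in U then p u else symdiff (p (other u (pe u))) [set pe u].
have p'U u : u \in U -> p' u = p u by rewrite /p' => ->.
pose Q' := Q :|: [set pe u | u in U' :\: U].
have U'W : U' \subset W.
  by rewrite subUset sUW; apply/subsetP => u; rewrite inE; case/andP.
have UU' : U \subset U' by apply: subsetUl.
have cQ' : #|Q'| <= #|U'|.
  have [+ _] := leq_card_setU Q [set pe u | u in U' :\: U].
  have : #|[set pe u | u in U' :\: U]| <= #|U' :\: U| by apply: leq_imset_card.
  by have := cardsID U U'; rewrite (setIidPr UU') /Q'; lia.
have Q'F : Q' \subset F.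
  rewrite subUset QF; apply/subsetP => _ /imsetP[u /peP /andP[+ _] ->].
  by rewrite inE => /andP[].
have p'P u : u \in U' -> [/\ p' u \subset Q', #|p' u| <= i.+1
    & forall x, flow x (p' u) = x v (+) x u].
  move=> uU'; rewrite /p'; case: ifPn => uU.
    have [pQ pi fp] := pU u uU.
    by split=> //; [apply: subset_trans pQ (subsetUl _ _) | apply: leqW].
  have uD : u \in U' :\: U by rewrite inE uU.
  have [oU xo] := otherP u (pe u) uU (peP u uD).
  have [pQ pi fp] := pU _ oU; split.
  - apply/subsetP => e; rewrite !inE; case: eqP => [->|_ /=].
      by move=> _; rewrite imset_f // orbT.
    by rewrite addbF => /(subsetP pQ) ->.
  - by apply: leq_trans (card_symdiff _ _) _; rewrite cards1 addn1.
  - move=> x; rewrite flow_symdiff flow1 fp xo.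
    by rewrite addbA; case: (x v); case: (x u); case: (x _).
have tQ' : touching U \subset Q'.
  apply/subsetP => e; rewrite !inE -in_setU -/Q' => /andP[/andP[eF /andP[lW rW]] lrU].
  have [//|eQ'] := boolP (e \in Q').
  have eW : e \in inside W by rewrite inE eF lW rW.
  have lU' : l e \in U'.
    rewrite !inE lW; case: (boolP (l e \in U)) => //= lU.
    by apply/existsP; exists e; rewrite /link eW eqxx /=; case/orP: lrU lU => ->.
  have rU' : r e \in U'.
    rewrite !inE rW; case: (boolP (r e \in U)) => //= rU.
    by apply/existsP; exists e; rewrite /link eW eqxx orbC /=; case/orP: lrU rU => ->.
  have [lQ cl fl] := p'P _ lU'; have [rQ cr fr] := p'P _ rU'.
  have clr : #|p' (l e)| + #|p' (r e)| <= 2 * i + 1.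
    have [lU|lU] := boolP (l e \in U).
      have [_ + _] := pU _ lU; rewrite -(p'U _ lU) => cl'.
      by rewrite (leq_trans (leq_add cl' cr)) // addnS addn1 mul2n addnn.
    have rU : r e \in U by case/orP: lrU lU => ->.
    have [_ + _] := pU _ rU; rewrite -(p'U _ rU) => cr'.
    by rewrite (leq_trans (leq_add cl cr')) // addSn addn1 mul2n addnn.
  (* The edge [e] closes the tree paths to its ends. One end is in [U], so the length is at most
     [1 + i + i.+1 <= 2 * k]; [e] itself does not cancel, being outside [Q']. *)
  case/existsP: noK; exists (symdiff [set e] (symdiff (p' (l e)) (p' (r e)))).
  have el : e \notin p' (l e) by apply: contra eQ'; apply: (subsetP lQ).
  have er : e \notin p' (r e) by apply: contra eQ'; apply: (subsetP rQ).
  apply/and4P; split.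
  - apply/subsetP => e'; rewrite !inE; case: eqP => [-> _ //|_ /= lr].
    apply: (subsetP Q'F); move: lr.
    by case: (boolP (e' \in p' (l e))) => [/(subsetP lQ)|_ /(subsetP rQ)].
  - by apply/set0Pn; exists e; rewrite !inE eqxx (negPf el) (negPf er).
  - have := card_symdiff [set e] (symdiff (p' (l e)) (p' (r e))).
    have := card_symdiff (p' (l e)) (p' (r e)).
    rewrite cards1 => h1 h2; apply: leq_trans h2 _.
    by clear -ik h1 clr; lia.
  - apply/forallP => x; rewrite !flow_symdiff flow1 fl fr.
    by case: (x v); case: (x (l e)); case: (x (r e)).
exists U', p', Q'; split=> //.
(* Doubling: [2 * #|U| <= #|touching U| <= #|Q'| <= #|U'|]. *)
have := touch U sUW; have := subset_leq_card tQ'; rewrite expnS; lia.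
Qed.

End ShortCycle.

(** * Queries reading two bits *)

Definition is_affine (g : bool -> bool -> bool) : bool :=
  ~~ (g false false (+) g false true (+) g true false (+) g true true).

Lemma affineE g a b : is_affine g -> g a b =
  g false false (+) ((g false false (+) g true false) && a
                     (+) ((g false false (+) g false true) && b)).
Proof.
rewrite /is_affine; case: a; case: b;
  move: (g false false) (g false true) (g true false) (g true true);
  by do 4!case.
Qed.

Definition majority (g : bool -> bool -> bool) : bool :=
  [|| g false false && g false true, g false false && g true false
    | g false true && g true false].

(** For nonaffine [g] the truth table splits three to one; this is the input with the exceptional
    value. *)
Definition odd_point (g : bool -> bool -> bool) : bool * bool :=
  ((g true false != majority g) || (g true true != majority g),
   (g false true != majority g) || (g true true != majority g)).

Lemma nonaffineE g a b : ~~ is_affine g ->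
  g a b = majority g (+) ((a == (odd_point g).1) && (b == (odd_point g).2)).
Proof.
rewrite /odd_point /majority /is_affine; case: a; case: b => /=;
  move: (g false false) (g false true) (g true false) (g true true);
  by do 4!case.
Qed.

(** Otherwise every edge has an endpoint met by no other edge, which injects [F] into [V]. *)
Lemma middle_edge (E V : finType) (l r : E -> V) (F : {set E}) :
  (#|V| < #|F|)%N -> exists e1 e e3,
    [/\ [/\ e1 \in F, e \in F & e3 \in F], e1 != e, e3 != e,
        (l e1 == l e) || (r e1 == l e) & (l e3 == r e) || (r e3 == r e)].
Proof.
move=> VF.
pose shared e v := [exists e' in F, (e' != e) && ((l e' == v) || (r e' == v))].
have [/existsP[e /and3P[eF]]|noE] :=
    boolP [exists e, [&& e \in F, shared e (l e) & shared e (r e)]].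
  by case/exists_inP=> e1 e1F /andP[? ?] /exists_inP[e3 e3F /andP[? ?]]; exists e1, e, e3.
pose private e := if shared e (l e) then r e else l e.
have privateN e : e \in F -> ~~ shared e (private e).
  move=> eF; rewrite /private; case: ifPn => // sl.
  by move: noE; rewrite negb_exists => /forallP/(_ e); rewrite eF sl.
have inj : {in F &, injective private}.
  move=> e e' eF e'F pe; apply/eqP; apply: contraT => ee'.
  case/negP: (privateN _ eF); apply/exists_inP; exists e' => //.
  rewrite eq_sym ee' pe /private; case: ifP => _; rewrite eqxx ?orbT //.
by have := max_card (private @: F); rewrite card_in_imset // leqNgt VF.
Qed.

Lemma square_le_exp k : (10 < k)%N -> (8 * (k * k) <= 2 ^ k)%N.
Proof.
elim: k => // k IHk; rewrite ltnS leq_eqVlt => /predU1P[<- //|k10].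
by have := IHk k10; rewrite expnS; nia.
Qed.

Section TwoBitQueries.
Variables (G : finZmodType) (V : finType) (n : nat).
Variables (l r : G -> V) (g : G -> bool -> bool -> bool).
Hypothesis n_gt1 : (1 < n)%N.
Hypothesis n_half : (2 * n < #|G|)%N.
Hypothesis realize : forall A B : {set G}, #|A| = n -> #|B| = n ->
  exists x : V -> bool, forall z, g z (x (l z)) (x (r z)) = (z \in sumset A B).

(* A nonaffine answer is c xor the conjunction of two literals; take literals *)
(* as vertices. In a path of three edges, if both end edges differ from c,    *)
(* so does the middle one.                                                    *)
Lemma nonaffine_bound c :
  (#|[set z | ~~ is_affine (g z) & majority (g z) == c]| <= 2 * #|V|)%N.
Proof.
set F := [set z | _ & _].
rewrite leqNgt; apply/negP => VF.
pose L z := (l z, (odd_point (g z)).1).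
pose R z := (r z, (odd_point (g z)).2).
have [|e1 [e [e3 [[e1F eF e3F] e1e e3e e1L e3R]]]] := @middle_edge G (V * bool)%type L R F.
  by rewrite card_prod card_bool mulnC.
pose holds (x : V -> bool) (v : V * bool) := x v.1 == v.2.
have gE x z : z \in F -> g z (x (l z)) (x (r z)) = c (+) (holds x (L z) && holds x (R z)).
  by rewrite inE => /andP[gz /eqP <-]; rewrite (nonaffineE _ _ gz).
have forced x : g e1 (x (l e1)) (x (r e1)) = ~~ c -> g e3 (x (l e3)) (x (r e3)) = ~~ c ->
    g e (x (l e)) (x (r e)) = ~~ c.
  rewrite !gE // => h1 h3.
  have {h1}/andP[L1 R1] : holds x (L e1) && holds x (R e1) by move: h1; case: (c); case: (_ && _).
  have {h3}/andP[L3 R3] : holds x (L e3) && holds x (R e3) by move: h3; case: (c); case: (_ && _).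
  have -> : holds x (L e) by case/orP: e1L => /eqP <-.
  have -> : holds x (R e) by case/orP: e3R => /eqP <-.
  by rewrite addbT.
suff [A [B [cA cB s1 s3 s]]] : exists A B : {set G}, [/\ #|A| = n, #|B| = n,
    (e1 \in sumset A B) = ~~ c, (e3 \in sumset A B) = ~~ c & (e \in sumset A B) = c].
  have [x xE] := realize cA cB; have := forced x.
  by rewrite !xE s1 s3 s; case: (c) => /(_ erefl erefl).
case: (c).
  have [||||A [B [cA cB se /negPf s1 /negPf s3]]] := @avoid_two_hit G e e1 e3 n;
    rewrite 1?eq_sym //; first exact: ltnW.
  by exists A, B.
(* Conjunctions: the set to cover may have two elements, which fits as [1 < n]. *)
have [|||A [B [cA cB /subsetP sZ /negPf se]]] := @cover_avoid G [set e1; e3] e n.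
- by rewrite !inE negb_or ![e == _]eq_sym e1e.
- by rewrite cards2; apply: leq_trans n_gt1; case: (_ != _).
- exact: ltnW.
by exists A, B; split=> //; apply: sZ; rewrite !inE eqxx ?orbT.
Qed.

(* None is a ground vertex of value false, for the bits on which an affine    *)
(* answer does not depend. The xor of the answers over a cycle is constant.   *)
Lemma affine_bound : (1024 <= #|G|)%N -> (#|V| < #|G|)%N ->
  (#|[set z | is_affine (g z)]| <= 2 * #|V|.+1)%N.
Proof.
move=> bigG VG; set F := [set z | _].
rewrite leqNgt; apply/negP => VF.
pose k := (trunc_log 2 #|G|).+1.
have [k_lo k_hi] : (2 ^ k <= 2 * #|G| /\ #|G| < 2 ^ k)%N.
  have G0 : (0 < #|G|)%N by lia.
  by have /andP[lo hi] := trunc_log_bounds (isT : (1 < 2)%N) G0; split=> //; rewrite expnS leq_mul2l.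
(* If [#|K| > n], then [n * (#|K| + 1) <= #|K| ^ 2 - 1 <= #|G|], so the bound with [#|G|.+1]
   suffices below. *)
have k_small : (2 * k * (2 * k) <= #|G|.+1)%N.
  have k11 : (10 < k)%N by rewrite -(ltn_exp2l _ _ (isT : (1 < 2)%N)); apply: leq_ltn_trans k_hi.
  by have := square_le_exp k11; lia.
pose c1 z := g z false false (+) g z true false.
pose c2 z := g z false false (+) g z false true.
pose l' z := if c1 z then Some (l z) else None.
pose r' z := if c2 z then Some (r z) else None.
have [||K [sKF K0 cK flowK]] := @short_cycle G (option V) l' r' F k.
- by rewrite card_option.
- by rewrite card_option; apply: leq_ltn_trans k_hi.
have gE x z : z \in F -> g z (x (l z)) (x (r z)) =
    g z false false (+) (oapp x false (l' z) (+) oapp x false (r' z)).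
  rewrite inE => /affineE ->; rewrite /l' /r' -/(c1 z) -/(c2 z).
  by case: (c1 z); case: (c2 z).
have sumK (A B : {set G}) : #|A| = n -> #|B| = n ->
    \big[addb/false]_(z in K) (z \in sumset A B)
    = \big[addb/false]_(z in K) g z false false.
  move=> cA cB; have [x xE] := realize cA cB.
  rewrite -[RHS]addbF -[X in _ (+) X](flowK (oapp x false)) /flow -big_split /=.
  by apply: eq_bigr => z zK; rewrite -xE gE // (subsetP sKF).
have [|||t [A [B [A' [B' [tK [cA cB cA' cB'] tAB tAB' same]]]]]] := @flip_one G K n K0.
- exact: ltnW.
- exact: ltnW.
- have := leq_trans (leq_mul cK cK) k_small; move: #|K| => w w_small.
  by case: (leqP w n) => //= nw; rewrite -ltnS; apply: leq_trans w_small; nia.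
have := sumK _ _ cA cB; rewrite -(sumK _ _ cA' cB') !(bigD1 t tK) /= tAB (negPf tAB').
rewrite (eq_bigr (fun z => z \in sumset A' B')) => [|z /andP[zK zt]]; last exact: same.
by move/addIb.
Qed.
End TwoBitQueries.

(** * From data structures to two-bit queries, and the final count *)

Lemma card_le2_sub (T : finType) (x0 : T) (P : {set T}) :
  (#|P| <= 2)%N -> exists x y, P \subset [set x; y].
Proof.
have [->|[x xP]] := set_0Vmem P; first by exists x0, x0; rewrite sub0set.
rewrite (cardsD1 x) xP; have [P0|[y yP]] := set_0Vmem (P :\ x).
  exists x, x; apply/subsetP => z zP; move/setP/(_ z): P0.
  by rewrite !inE zP andbT; case: eqP.
rewrite (cardsD1 y) yP => P0; exists x, y; apply/subsetP => z zP.
apply: contraT; rewrite !inE negb_or => /andP[zx zy].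
have : z \in P :\ x :\ y by rewrite !inE zx zy.
by rewrite (cards0_eq (_ : #|P :\ x :\ y| = 0%N)) ?inE //; lia.
Qed.

Definition bit_memory (S : nat) (x : 'I_S -> bool) : memory S 1 :=
  [ffun i => [tuple x i]].

Lemma bit_memoryP S (m : memory S 1) : exists x, m = bit_memory x.
Proof.
exists (fun i => thead (m i)); apply/ffunP => i; rewrite ffunE.
by apply/val_inj; case: (m i) => [[|b []]].
Qed.

Lemma query_two_bits (G : finZmodType) S (D : nonadaptive_ds G S 1) (i0 : 'I_S) z :
  (#|probes D z| <= 2)%N -> exists lrg : 'I_S * 'I_S * (bool -> bool -> bool),
    forall x, query D (bit_memory x) z = lrg.2 (x lrg.1.1) (x lrg.1.2).
Proof.
case/(card_le2_sub i0) => l [r sP].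
(* A memory holding [a] in cell [l] and [b] in all others agrees with [x] on the probed cells. *)
exists (l, r, fun a b => query D (bit_memory (fun i => if i == l then a else b)) z) => x /=.
rewrite /query; congr answer; apply/ffunP => i; rewrite !ffunE; case: ifP => // iP.
have := subsetP sP i iP; rewrite !inE; case: eqP => [-> //|_ /= /eqP ->//].
Qed.

Lemma solves_realize (G : finZmodType) S n (D : nonadaptive_ds G S 1) (A B : {set G}) :
  solves_3SUM_indexing n 2 D -> #|A| = n -> #|B| = n ->
  exists x, forall z, query D (bit_memory x) z = (z \in sumset A B).
Proof.
case=> _ DP cA cB; have [x xE] := bit_memoryP (preprocess D A B).
exists x => z; rewrite -xE; apply/idP/imset2P.
  by case/(DP A B cA cB) => a [b [aA bB <-]]; exists a b.
by case=> a b aA bB ->; apply/(DP A B cA cB); exists a, b.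
Qed.

(** The three classes have at most [2 * (S + 1) + 4 * S <= 8 * S] queries together. The factor 1024
    ensures [1024 <= #|G|] in the contradiction case, as [affine_bound] requires. *)
Lemma space_bound (G : finZmodType) (n S : nat) (D : nonadaptive_ds G S 1) :
  (1 < n)%N -> (2 * n < #|G|)%N -> solves_3SUM_indexing n 2 D ->
  (#|G| <= 1024 * S)%N.
Proof.
move=> n1 nG DP; have n0 := ltnW n1; have nG' := ltnW nG.
(* Without cells the answers cannot depend on the input. *)
have [i0 _|noS] := pickP (@predT 'I_S); last first.
  have [||A [B [cA cB /subsetP sAB]]] := @cover_all G [set 0] n n0; rewrite ?cards1 //.
    by lia.
  have [|||A' [B' [cA' cB' _ /negP tN]]] := @cover_avoid G set0 0 n; rewrite ?inE ?cards0 //.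
  have [x xE] := solves_realize DP cA cB; have [x' x'E] := solves_realize DP cA' cB'.
  case: tN; rewrite -x'E; have -> : bit_memory x' = bit_memory x.
    by apply/ffunP => i; have := noS i.
  by rewrite xE sAB // inE.
have S0 : (0 < S)%N by apply: leq_ltn_trans (ltn_ord i0).
rewrite leqNgt; apply/negP => SG.
have [lrg lrgE] := fin_all_exists (fun z => query_two_bits i0 (DP.1 z)).
pose l z := (lrg z).1.1; pose r z := (lrg z).1.2; pose g z := (lrg z).2.
have realize (A B : {set G}) : #|A| = n -> #|B| = n ->
    exists x : 'I_S -> bool, forall z, g z (x (l z)) (x (r z)) = (z \in sumset A B).
  by move=> cA cB; have [x xE] := solves_realize DP cA cB; exists x => z; rewrite -xE lrgE.
have S_small : (#|'I_S| < #|G|)%N by rewrite card_ord; clear -SG; lia.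
have G_big : (1024 <= #|G|)%N by clear -S0 SG; lia.
have := affine_bound n1 nG realize G_big S_small.
have := nonaffine_bound n1 nG realize true.
have := nonaffine_bound n1 nG realize false.
rewrite card_ord.
set Ea := [set z | is_affine (g z)].
set E0 := [set z | _ & majority _ == false]; set E1 := [set z | _ & majority _ == true].
have : (#|G| <= #|Ea| + (#|E0| + #|E1|))%N.
  rewrite -card_setT (_ : [set: G] = Ea :|: (E0 :|: E1)).
    have [c01 _] := leq_card_setU E0 E1; have [ca _] := leq_card_setU Ea (E0 :|: E1).
    by apply: leq_trans ca _; rewrite leq_add2l.
  by apply/setP => z; rewrite !inE; case: (is_affine _); case: (majority _).
by clear -S0 SG; lia.
Qed.

Theorem theorem5 :
  exists c : rat, 0 < c /\
  forall (G : finZmodType) (n S : nat),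
    (2 <= n)%N -> (2 * n < #|G|)%N ->
    forall D : nonadaptive_ds G S 1,
      solves_3SUM_indexing n 2 D -> c * #|G|%:R <= S%:R.
Proof.
exists 1024%:R^-1; split; first by rewrite invr_gt0 ltr0Sn.
move=> G n S n2 nG D DP.
rewrite mulrC ler_pdivrMr; last exact: ltr0Sn.
by rewrite -natrM ler_nat mulnC (space_bound n2 nG DP).
Qed.
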